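(* Let $(M,F)$ be a conic pseudo-Finsler surface with $F$ defined on the conic sub-bundle $\mathcal A$, let $\phi:\mathcal A\to\mathbb R$ be a smooth function that is positively homogeneous of degree $0$ in $y$, and let $\overline F=e^{\phi}F$. Then $(M,\overline F)$ is a conic pseudo-Finsler surface (i.e. $\overline F$ is a conic pseudo-Finsler metric on $\mathcal A$) if and only if, at every point of $\mathcal A$, $$\sigma-(\phi_{;2})^2+\varepsilon=F^2\big[\dot\partial_i\dot\partial_j\phi+(\dot\partial_i\phi)(\dot\partial_j\phi)\big]m^im^j+\varepsilon\neq 0 ,$$ where $\sigma=\phi_{;2;2}+\varepsilon\mathcal I\phi_{;2}+2(\phi_{;2})^2$ (the equality of the two expressions being part of the assertion).
   Context: Let $M$ be a smooth 2-dimensional manifold, $(x^1,x^2)$ local coordinates and $(x^i,y^i)$ the induced coordinates on $TM$; all formulas are in such a coordinate system and repeated indices are summed over $\{1,2\}$. Write $\partial_i=\partial/\partial x^i$, $\dot\partial_i=\partial/\partial y^i$. A function is $h(r)$ if it is positively homogeneous of degree $r$ in $y$. A conic sub-bundle is a non-empty open subset $\mathcal A\subset TM\setminus 0$ projecting onto $M$ and closed under multiplication by positive scalars. A conic pseudo-Finsler metric on $M$ is a smooth $h(1)$ function $F:\mathcal A\to\mathbb R$ such that $g_{ij}=\tfrac12\dot\partial_i\dot\partial_jF^2$ is non-degenerate at each point of $\mathcal A$; $(g^{ij})$ is the inverse matrix. A conic pseudo-Finsler surface is equipped with its modified Berwald frame: $F$ is nowhere zero on $\mathcal A$, $\ell_i=\dot\partial_iF$,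 $\ell^i=y^i/F$, $\varepsilon\in\{1,-1\}$ (the signature) is the sign of $\det(g_{ij})$, $m_1=-\sqrt{\varepsilon\det(g_{ij})}\,\ell^2$, $m_2=\sqrt{\varepsilon\det(g_{ij})}\,\ell^1$, $m^i=g^{ij}m_j$; thus $g_{ij}=\ell_i\ell_j+\varepsilon m_im_j$, $\ell^im_i=0$, $m^im_i=\varepsilon$. The main scalar $\mathcal I$ is the function on $\mathcal A$ defined by $F\,C_{ijk}=\mathcal I\,m_im_jm_k$, where $C_{ijk}=\tfrac12\dot\partial_kg_{ij}$. For a smooth function $f$ on $\mathcal A$, $f_{;2}:=\varepsilon F(\dot\partial_if)m^i$ and $f_{;2;2}:=(f_{;2})_{;2}$. *)

(* Defs.v *)
From HB Require Import structures.
From mathcomp Require Import all_boot all_order all_algebra.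
From mathcomp Require Import all_classical all_reals all_analysis.

Set Implicit Arguments.
Unset Strict Implicit.
Unset Printing Implicit Defensive.

Import Order.TTheory GRing.Theory Num.Theory.
Import numFieldNormedType.Exports.

Local Open Scope classical_set_scope.
Local Open Scope ring_scope.

(** * Smooth functions on open sets

    [U] is meant to be open and [V] finite-dimensional: [f] is of class
    C^(n+1) on [U] when it is differentiable there and each of its directional
    derivatives is of class C^n. *)

Fixpoint class_C (R : realType) (V W : normedModType R) (n : nat) (U : set V)
    (f : V -> W) : Prop :=
  match n with
  | 0 => forall x, U x -> {for x, continuous f}
  | n.+1 => (forall x, U x -> differentiable f x) /\
            (forall v, class_C n U (fun x => 'D_v f x))
  end.

Definition smooth_on (R : realType) (V W : normedModType R) (U : set V)
    (f : V -> W) : Prop := forall n, class_C n U f.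

(** * Smooth surfaces and their tangent bundle *)

Record chart (R : realType) (M : topologicalType) := Chart {
  chart_dom : set M;
  chart_map : M -> 'rV[R]_2;
  chart_inv : 'rV[R]_2 -> M;
  chart_dom_open : open chart_dom;
  chart_img_open : open (chart_map @` chart_dom);
  chart_mapK : forall p, chart_dom p -> chart_inv (chart_map p) = p;
  chart_map_cont : {within chart_dom, continuous chart_map};
  chart_inv_cont : {within chart_map @` chart_dom, continuous chart_inv}
}.

Definition transition (R : realType) (M : topologicalType) (c d : chart R M) :
  'rV[R]_2 -> 'rV[R]_2 := chart_map d \o chart_inv c.

Record smooth_surface (R : realType) := SmoothSurface {
  surf_carrier :> topologicalType;
  surf_hausdorff : hausdorff_space surf_carrier;
  surf_second_countable : @second_countable surf_carrier;
  surf_atlas : set (chart R surf_carrier);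
  surf_cover : forall p : surf_carrier,
    exists2 c, surf_atlas c & chart_dom c p;
  surf_transition_smooth : forall c d, surf_atlas c -> surf_atlas d ->
    smooth_on (chart_map c @` (chart_dom c `&` chart_dom d)) (transition c d)
}.

Definition chart_at (R : realType) (M : smooth_surface R) (c : chart R M)
    (p : M) : Prop := surf_atlas c /\ chart_dom c p.

(** A tangent vector at [p] is the family of its components in the charts
    around [p], related by the differentials of the transition maps.  The
    components in the other charts carry no information and are set to [0], so
    that equal tangent vectors are equal elements of [tangent M]. *)

Record tangent (R : realType) (M : smooth_surface R) := Tangent {
  tbase : M;
  tcomp : chart R M -> 'rV[R]_2;
  tcomp_out : forall c, ~ chart_at c tbase -> tcomp c = 0;
  tcomp_change : forall c d, chart_at c tbase -> chart_at d tbase ->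
    tcomp d = 'd (transition c d) (chart_map c tbase) (tcomp c)
}.

Section TangentBundle.
Variables (R : realType) (M : smooth_surface R).

Fact tscale_out (a : R) (v : tangent M) (c : chart R M) :
  ~ chart_at c (tbase v) -> a *: tcomp v c = 0.
Proof. by move=> /tcomp_out ->; rewrite scaler0. Qed.

Fact tscale_change (a : R) (v : tangent M) (c d : chart R M) :
  chart_at c (tbase v) -> chart_at d (tbase v) ->
  a *: tcomp v d =
    'd (transition c d) (chart_map c (tbase v)) (a *: tcomp v c).
Proof. by move=> cv dv; rewrite linearZ /= -tcomp_change. Qed.

Definition tscale (a : R) (v : tangent M) : tangent M :=
  @Tangent R M (tbase v) (fun c => a *: tcomp v c)
    (@tscale_out a v) (@tscale_change a v).

Fact tzero_change (p : M) (c d : chart R M) :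
  chart_at c p -> chart_at d p ->
  (0 : 'rV[R]_2) = 'd (transition c d) (chart_map c p) 0.
Proof. by rewrite linear0. Qed.

Definition tzero (p : M) : tangent M :=
  @Tangent R M p (fun=> 0) (fun _ _ => erefl) (@tzero_change p).

Definition tcoords (c : chart R M) (v : tangent M) : 'rV[R]_2 * 'rV[R]_2 :=
  (chart_map c (tbase v), tcomp v c).

Definition local_set (c : chart R M) (A : set (tangent M)) :
    set ('rV[R]_2 * 'rV[R]_2) :=
  tcoords c @` [set v | A v /\ chart_at c (tbase v)].

(** [local_fun c f] is [f] read in the coordinates of [c]; [tcoords c] is
    injective over the domain of [c], and the value is [0] outside the range
    of the coordinates. *)

Definition local_fun (c : chart R M) (f : tangent M -> R)
    (z : 'rV[R]_2 * 'rV[R]_2) : R :=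
  xget 0 [set a | exists2 v : tangent M,
                    chart_at c (tbase v) & tcoords c v = z /\ f v = a].

(** Functions on a subset [A] of [TM] are represented by total functions whose
    values outside [A] are irrelevant. *)

Definition smooth_fun (A : set (tangent M)) (f : tangent M -> R) : Prop :=
  forall c, surf_atlas c -> smooth_on (local_set c A) (local_fun c f).

Definition pos_homogeneous (A : set (tangent M)) (r : nat)
    (f : tangent M -> R) : Prop :=
  forall (v : tangent M) (a : R), A v -> 0 < a -> f (tscale a v) = a ^+ r * f v.

Record conic_subbundle (A : set (tangent M)) : Prop := ConicSubbundle {
  conic_nonempty : A !=set0;
  conic_open : forall c, surf_atlas c -> open (local_set c A);
  conic_nonzero : forall p, ~ A (tzero p);
  conic_onto : forall p, exists2 v, A v & tbase v = p;
  conic_scale : forall (v : tangent M) (a : R), A v -> 0 < a -> A (tscale a v)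
}.

End TangentBundle.

(** * The modified Berwald frame in the induced coordinates

    A point [z] of the coordinate domain is the pair [(x, y)]; the indices 1, 2
    of the coordinates are [0, 1 : 'I_2].  [L] is the metric function. *)

Section LocalFormulas.
Variable R : realType.
Local Notation E := ('rV[R]_2 * 'rV[R]_2)%type.

Definition dotd (i : 'I_2) (f : E -> R) (z : E) : R :=
  'D_((0 : 'rV[R]_2), (delta_mx 0 i : 'rV[R]_2)) f z.

Variable L : E -> R.

Definition metric_mx (z : E) : 'M[R]_2 :=
  \matrix_(i, j) (2^-1 * dotd i (dotd j (fun w => L w ^+ 2)) z).

Definition metric_inv (z : E) : 'M[R]_2 := invmx (metric_mx z).

(* The sign of a continuous nowhere zero function: locally constant. *)
Definition signature (z : E) : R := Num.sg (\det (metric_mx z)).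

Definition ell_up (i : 'I_2) (z : E) : R := z.2 0 i / L z.

Definition m_low (i : 'I_2) (z : E) : R :=
  let s := Num.sqrt (signature z * \det (metric_mx z)) in
  if i == 0 then - s * ell_up 1 z else s * ell_up 0 z.

Definition m_up (i : 'I_2) (z : E) : R :=
  \sum_j metric_inv z i j * m_low j z.

Definition cartan (i j k : 'I_2) (z : E) : R :=
  2^-1 * dotd k (fun w => metric_mx w i j) z.

Definition main_scalar (z : E) : R :=
  xget 0 [set a | forall i j k : 'I_2,
                    L z * cartan i j k z = a * m_low i z * m_low j z * m_low k z].

Definition semi2 (f : E -> R) (z : E) : R :=
  signature z * L z * \sum_i dotd i f z * m_up i z.

Definition sigma (phi : E -> R) (z : E) : R :=
  semi2 (semi2 phi) z + signature z * main_scalar z * semi2 phi z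
  + 2 * semi2 phi z ^+ 2.

End LocalFormulas.

(** * Conic pseudo-Finsler metrics *)

Record conic_pseudo_Finsler (R : realType) (M : smooth_surface R)
    (A : set (tangent M)) (F : tangent M -> R) : Prop := ConicPseudoFinsler {
  cpF_smooth : smooth_fun A F;
  cpF_homogeneous : pos_homogeneous A 1 F;
  cpF_nondegenerate : forall c v, A v -> chart_at c (tbase v) ->
    metric_mx (local_fun c F) (tcoords c v) \in unitmx
}.

(* Main.v *)
Require Import Defs.
From HB Require Import structures.
From mathcomp Require Import all_boot all_order all_algebra.
From mathcomp Require Import all_classical all_reals all_analysis.
From mathcomp Require Import ring.

Set Implicit Arguments.
Unset Strict Implicit.
Unset Printing Implicit Defensive.

Import Order.TTheory GRing.Theory Num.Theory.
Import numFieldNormedType.Exports.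

Local Open Scope classical_set_scope.
Local Open Scope ring_scope.

(** By Euler's relation the fibre Hessian [H] of an h(1) function [L] is
    annihilated by [y] in both slots, and so are the fibre derivatives of the
    h(0) matrix [g]; in dimension 2 all these tensors are therefore multiples of
    tensor powers of the covector [n = (- y^2, y^1)].  With [l = dL], [y . l = L]
    and [w = (- l_2, l_1)] one gets [det g = L H(w, w)], [m^i = (eps / s) w^i] for
    [s = sqrt (eps det g)], and [f_;2 = (L / s) (l_1 f_2 - l_2 f_1)], from which
    the formula for [sigma] follows by differentiating [s] along [m].
    For [K = e^f L], homogeneous of the same degree, the Hessian of [K] is also a
    multiple of [n (x) n]; contracting it with [w], which kills [l], gives
    [L^3 det g_K = K^3 e^f s^2 (L^2 (f_ij + f_i f_j) m^i m^j + eps)], so that the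
    two sides vanish together. *)

(** * Differentials and directional derivatives *)

(** The first-order expansion of [f] at [x] is also one for [g], because both agree near [x] and at
    [x]; uniqueness of the differential then concludes. *)
Lemma near_eq_differentiable (R : realType) (V W : normedModType R)
    (f g : V -> W) (x : V) :
  {near x, f =1 g} -> differentiable f x -> differentiable g x.
Proof.
move=> fg df.
have [cf ef] := (diff_locallyP x f).1 df.
have eg : g \o shift x = cst (g x) + 'd f x +o_ 0 id.
  apply/eqaddoP => _/posnumP[e].
  move/eqaddoP : ef => /(_ e%:num (gt0 e)).
  apply: filter_app.
  have := fg; rewrite (near_shift 0 x); apply: filter_app; near=> h.
  by rewrite /= subr0 !fctE /= => ->; rewrite (nbhs_singleton fg).
apply/diff_locallyP; rewrite (diff_unique cf eg); split => //.
Unshelve. all: by end_near. Qed.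

Lemma derive_line (K : numFieldType) (V W : normedModType K) (f : V -> W) (x v : V) :
  'D_v f x = 'D_1 (fun t : K => f (t *: v + x)) 0.
Proof.
rewrite /derive; set g1 := fun h => h^-1 *: _; set g2 := fun h => h^-1 *: _.
suff -> : g1 = g2 by [].
apply/funext => h; rewrite /g1 /g2 /=.
by rewrite !addr0 scale0r add0r [h *: 1]mulr1.
Qed.

(** Restriction to the line through [x] along [v] turns this into the one-variable chain rule. *)
Lemma is_derive_comp1 (R : realType) (V : normedModType R) (f : V -> R)
    (g : R -> R) (x v : V) (df dg : R) :
  is_derive x v f df -> is_derive (f x) 1 g dg ->
  is_derive x v (g \o f) (dg * df).
Proof.
move=> [fx <-] [gx <-].
have fx0 : f x = f (0 *: v + x) by rewrite scale0r add0r.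
have dl : derivable (fun t : R => f (t *: v + x)) 0 1 by exact: (derivable1P f x v).1.
rewrite fx0 in gx *.
apply: DeriveDef.
  apply: (derivable1P (g \o f) x v).2.
  apply/derivable1_diffP; apply: (differentiable_comp ((derivable1_diffP _ _).1 dl)).
  exact/derivable1_diffP.
rewrite [LHS]derive_line [in RHS](derive_line f) -!derive1E.
exact: (derive1_comp dl gx).
Qed.

Lemma is_derive_add (R : realType) (V : normedModType R) (f g : V -> R)
    (x v : V) (df dg : R) :
  is_derive x v f df -> is_derive x v g dg ->
  is_derive x v (fun w => f w + g w) (df + dg).
Proof. by move=> hf hg; exact: is_deriveD. Qed.

Lemma is_derive_mul (R : realType) (V : normedModType R) (f g : V -> R)
    (x v : V) (df dg : R) :
  is_derive x v f df -> is_derive x v g dg ->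
  is_derive x v (fun w => f w * g w) (df * g x + f x * dg).
Proof.
move=> hf hg; have := is_deriveM hf hg.
by rewrite -[_ *: dg + _]/(f x * dg + g x * df) addrC [df * _]mulrC.
Qed.

Lemma is_derive_sub (R : realType) (V : normedModType R) (f g : V -> R)
    (x v : V) (df dg : R) :
  is_derive x v f df -> is_derive x v g dg ->
  is_derive x v (fun w => f w - g w) (df - dg).
Proof. by move=> hf hg; exact: is_deriveB. Qed.

Lemma is_derive_inv (R : realType) (V : normedModType R) (f : V -> R)
    (x v : V) (df : R) :
  f x != 0 -> is_derive x v f df ->
  is_derive x v (fun w => (f w)^-1) (- (f x) ^- 2 * df).
Proof.
by move=> fx [hf <-]; apply: DeriveDef; [exact: derivableV|exact: deriveV].
Qed.

(** * Closure properties of the classes C^n on an open set *)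

Section smooth_closure.
Context (R : realType) (V : normedModType R) {U : set V}.
Hypothesis openU : open U.

Lemma near_eq_on (W : Type) (f g : V -> W) (x : V) :
  (forall y, U y -> f y = g y) -> U x -> {near x, f =1 g}.
Proof. by move=> fg Ux; apply: filterS fg (open_nbhs_nbhs _); split. Qed.

(** On an open set, equality on [U] is equality of germs, which is all that derivatives see. This
    lets derivative formulas valid only at points of [U] be used under [class_C]. *)
Lemma eq_class_C (W : normedModType R) n (f g : V -> W) :
  (forall x, U x -> f x = g x) -> class_C n U f -> class_C n U g.
Proof.
elim: n f g => [|n IHn] f g fg /=.
  move=> cf x Ux; rewrite /prop_for/continuous_at -fg//.
  apply: cvg_trans (cf x Ux).
  by apply: near_eq_cvg; exact: near_eq_on.
move=> [df cf]; split=> [x Ux|v].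
  by apply: near_eq_differentiable (df x Ux); exact: near_eq_on.
apply: (IHn _ _ _ (cf v)) => x Ux /=.
by apply: near_eq_derive; exact: near_eq_on.
Qed.

Lemma class_CW (W : normedModType R) n (f : V -> W) :
  class_C n.+1 U f -> class_C n U f.
Proof.
elim: n f => [|n IHn] f [df cf]; first by move=> x /df /differentiable_continuous.
by split=> // v; exact: IHn.
Qed.

Lemma class_CD (W : normedModType R) n (f g : V -> W) :
  class_C n U f -> class_C n U g -> class_C n U (fun x => f x + g x).
Proof.
elim: n f g => [|n IHn] f g.
  by move=> cf cg x Ux; apply: cvgD (cf x Ux) (cg x Ux).
move=> [df cf] [dg cg]; split=> [x Ux|v]; first by apply: differentiableD; auto.
apply: (eq_class_C (f := fun x => 'D_v f x + 'D_v g x)); last first.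
  exact: (IHn _ _ (cf v) (cg v)).
by move=> x Ux; rewrite [RHS]deriveD//; apply: diff_derivable; auto.
Qed.

Lemma class_CM n (f g : V -> R) :
  class_C n U f -> class_C n U g -> class_C n U (fun x => f x * g x).
Proof.
elim: n f g => [|n IHn] f g.
  by move=> cf cg x Ux; apply: cvgM (cf x Ux) (cg x Ux).
move=> Cf Cg; have [[df cf] [dg cg]] := (Cf, Cg).
split=> [x Ux|v]; first by apply: differentiableM; auto.
apply: (eq_class_C (f := fun x => f x * 'D_v g x + g x * 'D_v f x)).
  by move=> x Ux; rewrite [RHS]deriveM//; apply: diff_derivable; auto.
(* Each Leibniz term keeps one factor undifferentiated; [class_CW] lowers it to order [n]. *)
apply: class_CD; first exact: (IHn _ _ (class_CW Cf) (cg v)).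
exact: (IHn _ _ (class_CW Cg) (cf v)).
Qed.

Lemma class_C_cst (W : normedModType R) n (a : W) : class_C n U (fun=> a).
Proof.
elim: n a => [|n IHn] a; first by move=> x _; exact: cvg_cst.
split=> [x Ux|v]; first exact: differentiable_cst.
by rewrite (_ : 'D_v _ = fun=> 0); [exact: IHn|apply/funext => x; exact: derive_cst].
Qed.

Lemma class_C_expR n (f : V -> R) :
  class_C n U f -> class_C n U (fun x => expR (f x)).
Proof.
elim: n f => [|n IHn] f.
  by move=> cf x Ux; apply: continuous_comp; [exact: cf|exact: continuous_expR].
move=> Cf; have [df cf] := Cf.
have dexp (t : R) : differentiable (@expR R) t.
  exact/derivable1_diffP/derivable_expR.
split=> [x Ux|v]; first exact: (differentiable_comp (df x Ux)).
apply: (eq_class_C (f := fun x => expR (f x) * 'D_v f x)) => [x Ux|].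
  apply/esym; apply: derive_val.
  apply: (is_derive_comp1 (g := expR)) (is_derive_expR _).
  exact/derivableP/diff_derivable/df.
exact: (class_CM (IHn _ (class_CW Cf)) (cf v)).
Qed.

End smooth_closure.

(** * Homogeneity in the fibre variable *)

Section homogeneity.
Variable R : realType.
Local Notation E := ('rV[R]_2 * 'rV[R]_2)%type.
Variable U : set E.
Hypothesis openU : open U.

Definition homogeneous_on (r : nat) (f : E -> R) :=
  forall z a, U z -> 0 < a -> f (z.1, a *: z.2) = a ^+ r * f z.

Lemma fibre_dirE (z : E) : ((0, z.2) : E) =
  z.2 0 0 *: ((0, delta_mx 0 0) : E) + z.2 0 1 *: ((0, delta_mx 0 1) : E).
Proof.
congr pair => /=; first by rewrite !scaler0 addr0.
apply/rowP => -[[|[|//]] i]; rewrite !mxE /= ?mulr1 ?mulr0 ?addr0 ?add0r;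
  by congr (z.2 0 _); apply/val_inj.
Qed.

(** The left side is the derivative of [f] along (0, y), hence that of t |-> f(x, (1 + t) y) at t =
    0, and homogeneity gives (1 + t)^r f(z) as soon as 1 + t > 0. *)
Lemma euler r (f : E -> R) z : homogeneous_on r f -> U z -> differentiable f z ->
  z.2 0 0 * dotd 0 f z + z.2 0 1 * dotd 1 f z = r%:R * f z.
Proof.
move=> hf Uz df.
rewrite /dotd !deriveE// -[LHS]/(_ *: _ + _ *: _) -!linearZ -linearD.
rewrite -fibre_dirE -deriveE//.
rewrite derive_line.
have -> : 'D_1 (fun t : R => f (t *: (0, z.2) + z)) 0 =
          'D_1 (fun t : R => (t + 1) ^+ r * f z) 0.
  apply: near_eq_derive; near=> t.
  rewrite -hf//.
    congr f; congr pair => /=; first by rewrite scaler0 add0r.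
    by rewrite scalerDl scale1r.
  by rewrite -ltrBlDr sub0r; near: t; apply: lt_nbhsr; rewrite oppr_lt0.
have t1 : is_derive (0 : R) 1 (fun t : R => t + 1) 1.
  exact: is_derive_shift.
have tr : is_derive (0 : R) 1 (fun t : R => (t + 1) ^+ r * f z) (r%:R * f z).
  have tX := is_deriveX r t1; rewrite exprfctE in tX.
  have := is_derive_mul tX (is_derive_cst (f z) (0 : R) (1 : R)).
  by rewrite mulr0 addr0 add0r expr1n mulr1 [_ *: 1]mulr1.
exact: derive_val.
Unshelve. all: by end_near. Qed.

(** Differentiating f(x, a y) = a^(r+1) f(x, y) in y produces a factor [a] on the left, which
    cancels. *)
Lemma homogeneous_dotd r (f : E -> R) i : (forall z, U z -> differentiable f z) ->
  (forall z a, U z -> 0 < a -> U (z.1, a *: z.2)) ->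
  homogeneous_on r.+1 f -> homogeneous_on r (dotd i f).
Proof.
move=> df cU hf z a Uz a0.
apply: (mulfI (lt0r_neq0 a0)).
rewrite mulrA -exprS /dotd.
set e := (0, _) : E.
have -> : a * 'D_e f (z.1, a *: z.2) = 'D_(a *: e) f (z.1, a *: z.2).
  by rewrite !deriveE; [rewrite linearZ|exact/df/cU..].
have -> : 'D_(a *: e) f (z.1, a *: z.2) = 'D_e (fun w => f (w.1, a *: w.2)) z.
  rewrite /derive; set g1 := fun h => h^-1 *: _; set g2 := fun h => h^-1 *: _.
  suff -> : g1 = g2 by [].
  apply/funext => h; rewrite /g1 /g2 /=; congr (_ *: (f _ - _)).
  congr pair => /=; first by rewrite !scaler0.
  by rewrite scalerDr !scalerA mulrC.
rewrite -deriveMl; last exact/diff_derivable/df.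
apply: near_eq_derive.
have : nbhs z U by apply: open_nbhs_nbhs; split.
by apply: filterS => w Uw; rewrite hf.
Qed.

End homogeneity.

(** * Linear algebra in dimension 2 *)

Lemma ord2P (i : 'I_2) : i = 0 \/ i = 1.
Proof. by case: i => [[|[|//]] i]; [left|right]; apply/val_inj. Qed.

Lemma sum2 {V : nmodType} (F : 'I_2 -> V) : \sum_i F i = F 0 + F 1.
Proof. by rewrite big_ord_recl big_ord1; congr (_ + F _); apply/val_inj. Qed.

Lemma det2 {K : comPzRingType} (A : 'M[K]_2) :
  \det A = A 0 0 * A 1 1 - A 0 1 * A 1 0.
Proof.
rewrite (expand_det_row _ 0) sum2 /cofactor !det_mx11 !mxE /= expr0 expr1.
have -> : lift 0 0 = 1 :> 'I_2 by apply/val_inj.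
have -> : lift 1 0 = 0 :> 'I_2 by apply/val_inj.
ring.
Qed.

(* In dimension 2 the covectors annihilating [u] are the multiples of [rot u]. *)
Definition rot {K : pzRingType} (u : 'I_2 -> K) (i : 'I_2) : K :=
  if i == 0 then - u 1 else u 0.

(** The two sides differ by [l i] times the vanishing pairing of [y] with [u]. The normalising
    factor [L] stays on the left, so no division occurs. *)
Lemma annihilator2 {K : comPzRingType} (y l u : 'I_2 -> K) (L : K) i :
  y 0 * l 0 + y 1 * l 1 = L -> y 0 * u 0 + y 1 * u 1 = 0 ->
  L * u i = rot y i * (l 0 * u 1 - l 1 * u 0).
Proof.
move=> <- yu; rewrite /rot; have [->|->] := ord2P i => /=.
  rewrite -[LHS]subr0 -[X in _ - X](mulr0 (l 0)) -yu; ring.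
rewrite -[LHS]subr0 -[X in _ - X](mulr0 (l 1)) -yu; ring.
Qed.

(** [annihilator2] is applied to one slot at a time: contracting the first slot with [rot l] leaves
    a covector that still annihilates [y]. *)
Lemma annihilator22 {K : comPzRingType} (y l : 'I_2 -> K)
    (H : 'I_2 -> 'I_2 -> K) (L : K) (i j : 'I_2) :
  y 0 * l 0 + y 1 * l 1 = L ->
  (forall j, y 0 * H 0 j + y 1 * H 1 j = 0) ->
  (forall i, y 0 * H i 0 + y 1 * H i 1 = 0) ->
  L ^+ 2 * H i j = rot y i * rot y j *
    \sum_i \sum_j rot l i * rot l j * H i j.
Proof.
move=> yl yH Hy.
rewrite expr2 -mulrA (annihilator2 (u := H^~ j) i yl)// mulrCA.
rewrite (annihilator2 (u := fun j => l 0 * H 1 j - l 1 * H 0 j) j yl)//.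
  by rewrite !sum2 /rot /=; ring.
transitivity (l 0 * (y 0 * H 1 0 + y 1 * H 1 1) - l 1 * (y 0 * H 0 0 + y 1 * H 0 1)).
  ring.
by rewrite !Hy; ring.
Qed.

Lemma annihilator222 {K : comPzRingType} (y l : 'I_2 -> K)
    (T : 'I_2 -> 'I_2 -> 'I_2 -> K) (L : K) (i j k : 'I_2) :
  y 0 * l 0 + y 1 * l 1 = L ->
  (forall j k, y 0 * T 0 j k + y 1 * T 1 j k = 0) ->
  (forall i k, y 0 * T i 0 k + y 1 * T i 1 k = 0) ->
  (forall i j, y 0 * T i j 0 + y 1 * T i j 1 = 0) ->
  L ^+ 3 * T i j k = rot y i * rot y j * rot y k *
    \sum_i \sum_j \sum_k rot l i * rot l j * rot l k * T i j k.
Proof.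
move=> yl T1 T2 T3.
pose S k := \sum_i \sum_j rot l i * rot l j * T i j k.
have TS : L ^+ 2 * T i j k = rot y i * rot y j * S k.
  exact: (annihilator22 (H := fun i j => T i j k)).
rewrite exprS -mulrA TS mulrCA (annihilator2 (u := S) k yl).
  by rewrite /S !sum2 /rot /=; ring.
transitivity (\sum_i \sum_j rot l i * rot l j * (y 0 * T i j 0 + y 1 * T i j 1)).
  by rewrite /S !sum2; ring.
by rewrite !sum2 !T3; ring.
Qed.

(** * Euler relations, Hessian and metric of an h(1) function *)

Section berwald_frame.
Variable R : realType.
Local Notation E := ('rV[R]_2 * 'rV[R]_2)%type.

Lemma is_derive_fibre_coord (i : 'I_2) (z v : E) :
  is_derive z v (fun w : E => w.2 0 i) (v.2 0 i).
Proof.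
have H : \forall h \near (0 : R)^',
    h^-1 *: (((fun w : E => w.2 0 i) \o shift z) (h *: v) - z.2 0 i) = v.2 0 i.
  near=> h.
  rewrite /= !mxE addrK -[LHS]/(_ * _) mulrA mulVf ?mul1r//.
  by near: h; exact: nbhs_dnbhs_neq.
apply: DeriveDef; first exact: is_cvg_near_cst H.
exact: lim_near_cst H.
Unshelve. all: by end_near. Qed.

(** Leibniz rule for y . u = k, where differentiating the coordinate y^i leaves [u i]. It gives
    Euler relations in slots other than that of the last derivative. *)
Lemma is_derive_contract (u : 'I_2 -> E -> R) (du : 'I_2 -> R) (k : E -> R) z i dk :
  (forall j, is_derive z ((0, delta_mx 0 i) : E) (u j) (du j)) ->
  is_derive z ((0, delta_mx 0 i) : E) k dk ->
  {near z, (fun w : E => w.2 0 0 * u 0 w + w.2 0 1 * u 1 w) =1 k} ->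
  z.2 0 0 * du 0 + z.2 0 1 * du 1 = dk - u i z.
Proof.
move=> hu hk e.
have d0 := is_derive_mul (is_derive_fibre_coord 0 z _) (hu 0).
have d1 := is_derive_mul (is_derive_fibre_coord 1 z _) (hu 1).
have [_ d] := near_eq_is_derive e (is_derive_add d0 d1).
have [_ d'] := hk.
rewrite -d' d; have [->|->] := ord2P i; rewrite !mxE /=; ring.
Qed.

Variables (U : set E) (L : E -> R).
Hypotheses (openU : open U)
  (coneU : forall z a, U z -> 0 < a -> U (z.1, a *: z.2)).

Lemma smooth_dotd (f : E -> R) i : smooth_on U f -> smooth_on U (dotd i f).
Proof. by move=> sf n; have [_] := sf n.+1; apply. Qed.

Lemma smooth_differentiable (f : E -> R) z : smooth_on U f -> U z -> differentiable f z.
Proof. by move=> sf Uz; have [+ _] := sf 1%N; apply. Qed.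

Lemma smooth_is_derive (f : E -> R) i z : smooth_on U f -> U z ->
  is_derive z ((0, delta_mx 0 i) : E) f (dotd i f z).
Proof.
by move=> sf Uz; exact/derivableP/diff_derivable/(smooth_differentiable sf Uz).
Qed.

Hypotheses (smL : smooth_on U L) (homL : homogeneous_on U 1 L).

Local Notation l i := (dotd i L).
Local Notation lv z := (fun a => dotd a L z).
Local Notation H i j := (dotd i (dotd j L)).

Lemma L_euler z : U z -> z.2 0 0 * l 0 z + z.2 0 1 * l 1 z = L z.
Proof.
move=> Uz; rewrite (@euler _ U 1%N L)// ?mul1r//.
exact: smooth_differentiable.
Qed.

Lemma hess_euler_l z j : U z -> z.2 0 0 * H 0 j z + z.2 0 1 * H 1 j z = 0.
Proof.
move=> Uz; rewrite (@euler _ U 0%N (dotd j L))// ?mul0r//.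
  by apply: homogeneous_dotd => // w Uw; exact: smooth_differentiable.
by apply: smooth_differentiable => //; exact: smooth_dotd.
Qed.

(* Together with [hess_euler_l] this replaces the symmetry of second derivatives:
   a matrix annihilated by [y] on both sides is a multiple of [rot y] (x) [rot y]. *)
Lemma hess_euler_r z i : U z -> z.2 0 0 * H i 0 z + z.2 0 1 * H i 1 z = 0.
Proof.
move=> Uz.
have dl j := smooth_is_derive i (smooth_dotd j smL) Uz.
have dL := smooth_is_derive i smL Uz.
rewrite (is_derive_contract dl dL) ?subrr//.
by apply: (near_eq_on openU) => // w; exact: L_euler.
Qed.

Hypothesis (L_neq0 : forall z, U z -> L z != 0).

Definition fibre (z : E) (i : 'I_2) : R := z.2 0 i.

Definition fibre_hess (z : E) (u : 'I_2 -> R) : R :=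
  \sum_i \sum_j u i * u j * H i j z.

Local Notation h z := (fibre_hess z (rot (lv z))).

Lemma hess_rank1 z i j : U z ->
  L z ^+ 2 * H i j z = rot (fibre z) i * rot (fibre z) j * h z.
Proof.
move=> Uz; apply: annihilator22; first exact: L_euler.
  by move=> k; exact: hess_euler_l.
by move=> k; exact: hess_euler_r.
Qed.

Lemma smooth_L2 : smooth_on U (fun w => L w ^+ 2).
Proof. by move=> n; exact: class_CM (smL n) (smL n). Qed.

Lemma dotd_L2 z i : U z -> dotd i (fun w => L w ^+ 2) z = 2 * (L z * l i z).
Proof.
move=> Uz; have dL := smooth_is_derive i smL Uz.
have [_ d] := is_derive_mul dL dL.
by rewrite /dotd [LHS]d mulrC -mulr2n mulr_natl mulrC.
Qed.

Lemma metric_mxE z i j :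
  metric_mx L z i j = 2^-1 * dotd i (dotd j (fun w => L w ^+ 2)) z.
Proof. by rewrite mxE. Qed.

Lemma metricE z i j : U z -> metric_mx L z i j = l i z * l j z + L z * H i j z.
Proof.
move=> Uz; rewrite metric_mxE.
have e : {near z, (fun w => 2 * (L w * l j w)) =1 dotd j (fun w => L w ^+ 2)}.
  by apply: (near_eq_on openU) => // w Uw; rewrite dotd_L2.
have d := is_derive_mul (smooth_is_derive i smL Uz)
            (smooth_is_derive i (smooth_dotd j smL) Uz).
have [_ d2] := is_derive_mul (is_derive_cst (2 : R) z ((0, delta_mx 0 i) : E)) d.
rewrite /dotd -(near_eq_derive _ e) [X in _ * X]d2 mul0r add0r.
by rewrite mulKf// pnatr_eq0.
Qed.

(** Dividing [hess_rank1] by L^2 leaves a single scalar [k], so that later determinants become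
    rational identities in [k], [l], [y] and [L]. *)
Lemma hessE z : U z -> exists k, [/\ h z = L z ^+ 2 * k,
  forall i j, H i j z = rot (fibre z) i * rot (fibre z) j * k &
  forall i j, metric_mx L z i j =
    l i z * l j z + L z * (rot (fibre z) i * rot (fibre z) j * k)].
Proof.
move=> Uz; have L20 : L z ^+ 2 != 0 by rewrite expf_neq0// L_neq0.
have HE i j : H i j z = rot (fibre z) i * rot (fibre z) j * (h z / L z ^+ 2).
  by rewrite mulrA -hess_rank1// mulrC mulKf.
exists (h z / L z ^+ 2); split=> [|//|i j]; first by rewrite mulrC divfK.
by apply: etrans (metricE i j Uz) _; rewrite -HE.
Qed.

(** With n = [rot y], the determinant of l (x) l + L k n (x) n is L k (l_0 n_1 - l_1 n_0)^2, and the
    bracket is y . l = L. *)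
Lemma det_metricE z : U z -> \det (metric_mx L z) = L z * h z.
Proof.
move=> Uz; have yl := L_euler Uz.
have [k [-> _ gE]] := hessE Uz.
rewrite det2 !gE /rot /fibre /=.
by move: yl; move: (l 0 z) (l 1 z) (z.2 0 0) (z.2 0 1) (L z) => l0 l1 y0 y1 Lz <-; ring.
Qed.

Lemma metric_sym z i j : U z -> metric_mx L z i j = metric_mx L z j i.
Proof.
move=> Uz; have [k [_ _ gE]] := hessE Uz.
apply: etrans (gE i j) (etrans _ (esym (gE j i))).
exact: congr2 (mulrC _ _) (congr1 (fun t => L z * (t * k)) (mulrC _ _)).
Qed.

Lemma smooth_metric i j : smooth_on U (fun w => metric_mx L w i j).
Proof.
move=> n.
rewrite (_ : (fun w => _) = fun w => 2^-1 * dotd i (dotd j (fun w => L w ^+ 2)) w).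
  apply: (class_CM openU); first exact: class_C_cst.
  exact: (smooth_dotd i (smooth_dotd j smooth_L2)).
by apply/funext => w; rewrite metric_mxE.
Qed.

Lemma metric_homogeneous i j : homogeneous_on U 0 (fun w => metric_mx L w i j).
Proof.
move=> w a Uw a0.
have hL2 : homogeneous_on U 2 (fun w => L w ^+ 2).
  by move=> x b Ux b0; rewrite homL// expr1 exprMn.
have hd : homogeneous_on U 1 (dotd j (fun w => L w ^+ 2)).
  by apply: homogeneous_dotd => // x Ux; exact: smooth_differentiable smooth_L2 Ux.
have hdd : homogeneous_on U 0 (dotd i (dotd j (fun w => L w ^+ 2))).
  apply: homogeneous_dotd => // x Ux.
  exact: smooth_differentiable (smooth_dotd j smooth_L2) Ux.
apply: etrans (metric_mxE _ i j) (etrans (congr1 ( *%R _) (hdd _ _ Uw a0)) _).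
exact: etrans (mulrCA _ _ _) (congr1 ( *%R _) (esym (metric_mxE w i j))).
Qed.

(** * The fibre derivative of the metric, twice the Cartan tensor *)

Local Notation T i j k := (dotd k (fun w => metric_mx L w i j)).

Lemma dmetric_euler_k z i j : U z -> z.2 0 0 * T i j 0 z + z.2 0 1 * T i j 1 z = 0.
Proof.
move=> Uz; rewrite (@euler _ U 0%N (fun w => metric_mx L w i j))// ?mul0r//.
  exact: metric_homogeneous.
exact: smooth_differentiable (smooth_metric i j) Uz.
Qed.

(** Contracting the metric with y gives y^i g_ij = L l_j; differentiating along y^k leaves l_k l_j +
    L H_kj - g_kj, which vanishes by [metricE]. *)
Lemma dmetric_euler_i z j k : U z -> z.2 0 0 * T 0 j k z + z.2 0 1 * T 1 j k z = 0.
Proof.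
move=> Uz.
have dg i := smooth_is_derive k (smooth_metric i j) Uz.
have d := is_derive_mul (smooth_is_derive k smL Uz)
            (smooth_is_derive k (smooth_dotd j smL) Uz).
have e := is_derive_contract (u := fun i w => metric_mx L w i j)
  (du := fun i => T i j k z) dg d.
apply: etrans (e _) _; last by rewrite (metricE k j Uz) subrr.
apply: (near_eq_on openU) => // w Uw.
rewrite !(metricE _ _ Uw) -[RHS]addr0 -[in RHS](mulr0 (L w)) -(hess_euler_l j Uw).
move: (L_euler Uw).
move: (l 0 w) (l 1 w) (l j w) (H 0 j w) (H 1 j w) (w.2 0 0) (w.2 0 1) (L w).
by move=> l0 l1 lj h0 h1 y0 y1 Lw <-; ring.
Qed.

Lemma dmetric_sym z i j k : U z -> T i j k z = T j i k z.
Proof.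
move=> Uz; apply: near_eq_derive; apply: (near_eq_on openU) => // w Uw.
exact: metric_sym.
Qed.

(** Twice the Cartan tensor on three copies of [rot l]; up to powers of [L] and [vol], this is the
    main scalar. *)
Definition dmetric_rot z : R := \sum_i \sum_j \sum_k
  rot (lv z) i * rot (lv z) j * rot (lv z) k * T i j k z.

Lemma dmetric_rank1 z i j k : U z ->
  L z ^+ 3 * T i j k z =
  rot (fibre z) i * rot (fibre z) j * rot (fibre z) k * dmetric_rot z.
Proof.
move=> Uz.
apply: (annihilator222 (T := fun i j k => T i j k z)); first exact: L_euler.
- by move=> *; exact: dmetric_euler_i.
- by move=> i' k'; rewrite !(dmetric_sym i' _ _ Uz); exact: dmetric_euler_i.
- by move=> *; exact: dmetric_euler_k.
Qed.

Lemma dmetricE z i j k : U z ->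
  T i j k z =
  rot (fibre z) i * rot (fibre z) j * rot (fibre z) k * dmetric_rot z / L z ^+ 3.
Proof.
move=> Uz; have L0 := L_neq0 Uz.
by rewrite -(dmetric_rank1 _ _ _ Uz) mulrC mulKf// expf_neq0.
Qed.

(** * Signature, density, frame and main scalar *)

Hypothesis nondegL : forall z, U z -> metric_mx L z \in unitmx.

Lemma det_metric_neq0 z : U z -> \det (metric_mx L z) != 0.
Proof. by move=> Uz; rewrite -unitfE -unitmxE nondegL. Qed.

Lemma signature_sqr z : U z -> signature L z ^+ 2 = 1.
Proof. by move=> Uz; rewrite sqr_sg det_metric_neq0. Qed.

(* The density [sqrt (eps * det g)] in the definition of [m_low]. *)
Definition vol (z : E) : R := Num.sqrt (signature L z * \det (metric_mx L z)).

Lemma signature_det_gt0 z : U z -> 0 < signature L z * \det (metric_mx L z).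
Proof. by move=> Uz; rewrite -normrEsg normr_gt0 det_metric_neq0. Qed.

Lemma vol_gt0 z : U z -> 0 < vol z.
Proof. by move=> Uz; rewrite sqrtr_gt0 signature_det_gt0. Qed.

Lemma vol_sqr z : U z -> vol z ^+ 2 = signature L z * \det (metric_mx L z).
Proof. by move=> Uz; rewrite sqr_sqrtr// ltW// signature_det_gt0. Qed.

Lemma det_vol z : U z -> \det (metric_mx L z) = signature L z * vol z ^+ 2.
Proof.
by move=> Uz; rewrite vol_sqr// mulrA -expr2 signature_sqr// mul1r.
Qed.

Lemma m_lowE z i : m_low L i z = vol z / L z * rot (fibre z) i.
Proof.
rewrite /m_low /vol /ell_up /rot /fibre; case: ifP => _.
  by rewrite mulNr mulrN mulrA mulrAC.
by rewrite mulrA mulrAC.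
Qed.

(** Instead of computing the inverse matrix, one checks that g maps the candidate to [m_low]: l
    kills [rot l], n . [rot l] = L, and L^2 k = eps s^2 / L by the determinant formula. *)
Lemma m_upE z i : U z ->
  m_up L i z = signature L z / vol z * rot (lv z) i.
Proof.
move=> Uz; have V0 := lt0r_neq0 (vol_gt0 Uz).
pose u := \col_j (signature L z / vol z * rot (lv z) j).
have gu : metric_mx L z *m u = \col_j m_low L j z.
  apply/colP => j; rewrite [LHS]mxE sum2 [RHS]mxE ![u _ _]mxE m_lowE.
  have [k [hk _ gE]] := hessE Uz.
  have := det_metricE Uz.
  rewrite (det_vol Uz) hk => hd.
  rewrite (gE j 0) (gE j 1).
  have L0 := L_neq0 Uz; have yl := L_euler Uz.
  have e2 := signature_sqr Uz.
  move: (rot (fibre z) j) => nj; rewrite /rot /= /fibre.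
  move: V0 L0 yl e2 hd.
  move: (l j z) (l 0 z) (l 1 z) (z.2 0 0) (z.2 0 1) (L z) (vol z) (signature L z).
  move=> lj l0 l1 y0 y1 Lz s e s0 L0 yl e2 hd.
  transitivity (e / s * Lz * k * nj * (y0 * l0 + y1 * l1)); first by ring.
  rewrite yl; transitivity (e / s * (Lz * (Lz ^+ 2 * k)) / Lz * nj).
    by field; rewrite L0 s0.
  rewrite -hd; transitivity (e ^+ 2 * (s / Lz * nj)); last by rewrite e2 mul1r.
  by field; rewrite L0 s0.
transitivity ((invmx (metric_mx L z) *m \col_j m_low L j z) i 0).
  by rewrite mxE; apply: eq_bigr => j _; rewrite mxE.
by rewrite -gu mulKmx ?nondegL// mxE.
Qed.

(** The sign in [semi2] and the one in [m_up] multiply to 1, so only [vol] still involves the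
    signature. *)
Lemma semi2E g z : U z ->
  semi2 L g z = L z / vol z * (l 0 z * dotd 1 g z - l 1 z * dotd 0 g z).
Proof.
move=> Uz; rewrite /semi2 sum2 !(m_upE _ Uz) /rot /=.
have V0 := lt0r_neq0 (vol_gt0 Uz).
move: (signature_sqr Uz) V0.
move: (signature L z) (vol z) (dotd 0 g z) (dotd 1 g z) (l 0 z) (l 1 z) (L z).
move=> e s g0 g1 l0 l1 Lz e2 s0.
rewrite -[RHS]mul1r -e2; field.
exact: s0.
Qed.

(** By rank one, the derivative is n_k c / L^3, with c = [dmetric_rot], times the cofactor form of g
    on (n, n). There the n (x) n part of g drops out and the l (x) l part gives (y . l)^2 = L^2. *)
Lemma is_derive_det_metric z k : U z ->
  is_derive z ((0, delta_mx 0 k) : E) (fun w => \det (metric_mx L w))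
    (rot (fibre z) k * dmetric_rot z / L z).
Proof.
move=> Uz.
have dg i j := smooth_is_derive k (smooth_metric i j) Uz.
have := is_derive_sub (is_derive_mul (dg 0 0) (dg 1 1)) (is_derive_mul (dg 0 1) (dg 1 0)).
rewrite (_ : (fun w => _) = fun w => \det (metric_mx L w)); last first.
  by apply/funext => w; rewrite det2.
move=> d; apply: (is_derive_eq d).
have [r [_ _ gE]] := hessE Uz.
have L0 := L_neq0 Uz; have yl := L_euler Uz.
have TE i j := dmetricE i j k Uz.
rewrite (TE 0 0) (TE 0 1) (TE 1 0) (TE 1 1) !gE.
move: (dmetric_rot z) (rot (fibre z) k) => c n; rewrite /rot /= /fibre.
move: L0 yl; move: (l 0 z) (l 1 z) (z.2 0 0) (z.2 0 1) (L z) => l0 l1 y0 y1 Lz L0 yl.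
transitivity (n * c * (y0 * l0 + y1 * l1) ^+ 2 / Lz ^+ 3); first by field.
by rewrite yl; field.
Qed.

(** The product of eps at [z] with det g at [w] is continuous in [w] and positive at [w] = [z],
    hence positive nearby, which forces equal signs. *)
Lemma signature_locally_cst z : U z ->
  {near z, (fun w => signature L w) =1 cst (signature L z)}.
Proof.
move=> Uz.
have cD : {for z, continuous (fun w => signature L z * \det (metric_mx L w))}.
  apply: cvgM; first exact: cvg_cst.
  have dg i j := differentiable_continuous (smooth_differentiable (smooth_metric i j) Uz).
  rewrite (_ : (fun w => _) = fun w => metric_mx L w 0 0 * metric_mx L w 1 1 -
     metric_mx L w 0 1 * metric_mx L w 1 0); last by apply/funext => w; rewrite det2.
  rewrite [X in _ --> X]det2.
  by apply: cvgB; apply: cvgM; exact: dg.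
have pos : \forall w \near z, 0 < signature L z * \det (metric_mx L w).
  exact: (cvgr_gt _ cD _ (signature_det_gt0 Uz)).
apply: filterS pos => w; rewrite -sgr_cp0 => /eqP; rewrite sgrM sgr_id => sg1.
rewrite /= -[LHS]mul1r -(signature_sqr Uz) expr2 -mulrA.
by rewrite [X in _ * X]sg1 mulr1.
Qed.

Lemma is_derive_vol z k : U z ->
  is_derive z ((0, delta_mx 0 k) : E) vol
   (signature L z * (rot (fibre z) k * dmetric_rot z / L z) / (2 * vol z)).
Proof.
move=> Uz.
have d := is_derive_mul (is_derive_cst (signature L z) z ((0, delta_mx 0 k) : E))
  (is_derive_det_metric k Uz).
have d2 := is_derive_comp1 d (is_derive1_sqrt (signature_det_gt0 Uz)).
(* The sign is frozen at its value at [z] before the square root is differentiated. *)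
apply: (@near_eq_is_derive _ _ _ _ vol _ _ _ _ (is_derive_eq d2 _)).
  by apply: filterS (signature_locally_cst Uz) => w e; rewrite /vol e.
by rewrite /= mul0r add0r mulrC.
Qed.

(** [main_scalar] is a chosen solution, so the value must be shown both to solve the equations and
    to be the only solution. *)
Lemma main_scalarE z : U z -> main_scalar L z = L z * dmetric_rot z / (2 * vol z ^+ 3).
Proof.
move=> Uz; have V0 := lt0r_neq0 (vol_gt0 Uz).
have L0 := L_neq0 Uz; have yl := L_euler Uz.
have sol i j k : L z * cartan L i j k z =
    L z * dmetric_rot z / (2 * vol z ^+ 3) * m_low L i z * m_low L j z * m_low L k z.
  rewrite /cartan.
  rewrite (dmetricE _ _ _ Uz) !m_lowE.
  move: (rot _ i) (rot _ j) (rot _ k) (dmetric_rot _) L0 V0 => ni nj nk c.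
  move: (L z) (vol z) => Lz s L0 s0.
  by field; rewrite L0 s0.
apply: xget_unique => [//|a ha].
(* Since y . l = L is non-zero, so is y; hence some m_i is non-zero, and the component (i, i, i)
   determines the scalar. *)
have [i yi] : exists i, rot (fibre z) i != 0.
  have [y1|] := eqVneq (rot (fibre z) 0) 0; last by exists 0.
  have [y0|] := eqVneq (rot (fibre z) 1) 0; last by exists 1.
  move: y1 y0 L0; rewrite -yl /rot /fibre /=; move: (l 0 z) (l 1 z) => l0 l1 /eqP.
  by rewrite oppr_eq0 => /eqP -> ->; rewrite !mul0r addr0 eqxx.
have mi : m_low L i z != 0 by rewrite m_lowE !mulf_neq0// invr_eq0.
by have := ha i i i; rewrite sol => /(mulIf mi)/(mulIf mi)/(mulIf mi).
Qed.

End berwald_frame.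

(** * The conformal change by e^f *)

(** Here [dq] is the fibre gradient of f_;2. Differentiating the factor L contributes l_0 l_1 - l_1
    l_0 = 0; the derivative of s cancels the main scalar term; the H terms vanish because f_i and
    H_ij are multiples of n_i and n_i n_j. The second derivatives [P] and one square of f_;2
    remain. *)
Lemma sigma_algebra (K : numFieldType) (Lz s e c b k : K) (y l f : 'I_2 -> K)
    (H P : 'I_2 -> 'I_2 -> K) :
  s != 0 -> Lz != 0 -> y 0 * l 0 + y 1 * l 1 = Lz -> e ^+ 2 = 1 ->
  (forall i, f i = rot y i * b) ->
  (forall i j, H i j = rot y i * rot y j * k) ->
  let dq i := (l i * s^-1 + Lz * (- s ^- 2 *
      (e * (rot y i * c / Lz) / (2 * s)))) * (l 0 * f 1 - l 1 * f 0)
   + Lz / s * ((H i 0 * f 1 + l 0 * P i 1) - (H i 1 * f 0 + l 1 * P i 0)) in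
  Lz / s * (l 0 * dq 1 - l 1 * dq 0)
  + e * (Lz * c / (2 * s ^+ 3)) * (Lz / s * (l 0 * f 1 - l 1 * f 0))
  + 2 * (Lz / s * (l 0 * f 1 - l 1 * f 0)) ^+ 2
  - (Lz / s * (l 0 * f 1 - l 1 * f 0)) ^+ 2 =
  Lz ^+ 2 * (\sum_i \sum_j (P i j + f i * f j) *
                      (e / s * rot l i) * (e / s * rot l j)).
Proof.
move=> s0 L0 yl e2 fE HE /=.
transitivity (Lz ^+ 2 / s ^+ 2 * e ^+ 2 * (
   (P 0 0 + f 0 * f 0) * l 1 * l 1 - (P 0 1 + f 0 * f 1) * l 1 * l 0
   - (P 1 0 + f 1 * f 0) * l 0 * l 1 + (P 1 1 + f 1 * f 1) * l 0 * l 0));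
  last by rewrite !sum2 /rot /=; field.
rewrite e2 !fE !HE /rot /= -yl in L0 *.
by field; rewrite s0 L0.
Qed.

(** The mixed terms f_j l_i and f_i l_j disappear because l vanishes on [rot l]. *)
Lemma conformal_algebra (K : comPzRingType) (e Lz : K) (ll : 'I_2 -> K)
    (HH PP : 'I_2 -> 'I_2 -> K) (ff : 'I_2 -> K) :
  Lz * (\sum_i \sum_j rot ll i * rot ll j * (e *
     (Lz * (PP i j + ff i * ff j) + ff j * ll i + ff i * ll j + HH i j))) =
  e * (Lz ^+ 2 * (\sum_i \sum_j rot ll i * rot ll j * (PP i j + ff i * ff j))
     + Lz * \sum_i \sum_j rot ll i * rot ll j * HH i j).
Proof. by rewrite !sum2 /rot /=; ring. Qed.

Section conformal_change.
Variable R : realType.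
Local Notation E := ('rV[R]_2 * 'rV[R]_2)%type.
Variables (U : set E) (L : E -> R).
Hypotheses (openU : open U)
  (coneU : forall z a, U z -> 0 < a -> U (z.1, a *: z.2)).
Hypotheses (smL : smooth_on U L) (homL : homogeneous_on U 1 L)
  (L_neq0 : forall z, U z -> L z != 0)
  (nondegL : forall z, U z -> metric_mx L z \in unitmx).
Local Notation l i := (dotd i L).
Local Notation lv z := (fun a => dotd a L z).
Local Notation H i j := (dotd i (dotd j L)).

Variable f : E -> R.
Hypotheses (smf : smooth_on U f) (homf : homogeneous_on U 0 f).
Local Notation P i j := (dotd i (dotd j f)).

Lemma dotd_hom0E z : U z -> exists b, forall i, dotd i f z = rot (fibre z) i * b.
Proof.
move=> Uz; have L0 := L_neq0 Uz.
exists ((l 0 z * dotd 1 f z - l 1 z * dotd 0 f z) / L z) => i.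
apply: (mulfI L0); rewrite (annihilator2 (y := fibre z) (l := fun a => l a z)
  (u := fun i => dotd i f z) i (L_euler smL homL Uz)).
  by rewrite [RHS]mulrCA [X in _ = _ * X]mulrC divfK.
by rewrite (@euler _ U 0%N f)// ?mul0r//; exact: smooth_differentiable.
Qed.

Lemma dotd_semi2 z i : U z ->
  dotd i (semi2 L f) z =
   (l i z * (vol L z)^-1 + L z * (- (vol L z) ^- 2 *
      (signature L z * (rot (fibre z) i * dmetric_rot L z / L z) / (2 * vol L z)))) *
   (l 0 z * dotd 1 f z - l 1 z * dotd 0 f z)
   + L z / vol L z * ((H i 0 z * dotd 1 f z + l 0 z * P i 1 z)
       - (H i 1 z * dotd 0 f z + l 1 z * P i 0 z)).
Proof.
move=> Uz.
have e : {near z, (fun w => L w / vol L w *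
    (l 0 w * dotd 1 f w - l 1 w * dotd 0 f w)) =1 semi2 L f}.
  apply: (near_eq_on openU) => // w Uw.
  by rewrite (semi2E openU coneU smL homL L_neq0 nondegL).
have dv := is_derive_vol openU coneU smL homL L_neq0 nondegL i Uz.
have V0 := lt0r_neq0 (vol_gt0 nondegL Uz).
have dl j := smooth_is_derive i (smooth_dotd j smL) Uz.
have df j := smooth_is_derive i (smooth_dotd j smf) Uz.
have dB := is_derive_sub (is_derive_mul (dl 0) (df 1)) (is_derive_mul (dl 1) (df 0)).
have dL := smooth_is_derive i smL Uz.
have [_ d] := is_derive_mul (is_derive_mul dL (is_derive_inv V0 dv)) dB.
by rewrite /dotd -(near_eq_derive _ e) [LHS]d.
Qed.

Lemma sigmaE z : U z ->
  sigma L f z - semi2 L f z ^+ 2 + signature L z =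
  L z ^+ 2 * (\sum_i \sum_j (P i j z + dotd i f z * dotd j f z) *
                      m_up L i z * m_up L j z) + signature L z.
Proof.
move=> Uz; congr (_ + _).
have V0 := lt0r_neq0 (vol_gt0 nondegL Uz).
have L0 := L_neq0 Uz; have yl := L_euler smL homL Uz.
have e2 := signature_sqr nondegL Uz.
have [b fE] := dotd_hom0E Uz.
have [k [_ HE _]] := hessE openU coneU smL homL L_neq0 Uz.
rewrite /sigma (main_scalarE openU coneU smL homL L_neq0 nondegL Uz).
(* The outer derivation is expanded first; the derivatives of [semi2 L f] that it leaves are
   supplied by [dotd_semi2]. *)
rewrite (semi2E openU coneU smL homL L_neq0 nondegL (semi2 L f) Uz).
rewrite (semi2E openU coneU smL homL L_neq0 nondegL f Uz) !(dotd_semi2 _ Uz).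
under [X in _ = _ * X]eq_bigr => i _ do under eq_bigr => j _ do
  rewrite !(m_upE openU coneU smL homL L_neq0 nondegL _ Uz).
exact: (sigma_algebra (y := fibre z) (l := lv z) (f := fun i => dotd i f z)
  (H := fun i j => H i j z) (dmetric_rot L z) (fun i j => P i j z) V0 L0 yl e2 fE HE).
Qed.

Definition conformal (w : E) : R := expR (f w) * L w.

Lemma conformal_smooth : smooth_on U conformal.
Proof. by move=> n; exact: (class_CM openU (class_C_expR openU (smf n)) (smL n)). Qed.

Lemma conformal_homogeneous : homogeneous_on U 1 conformal.
Proof. by move=> z a Uz a0; rewrite /conformal homf// homL// expr0 mul1r mulrCA. Qed.

Lemma conformal_neq0 z : U z -> conformal z != 0.
Proof. by move=> Uz; rewrite mulf_neq0 ?L_neq0// gt_eqF// expR_gt0. Qed.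

Lemma is_derive_expR_comp z i : U z ->
  is_derive z ((0, delta_mx 0 i) : E) (fun w => expR (f w)) (expR (f z) * dotd i f z).
Proof.
move=> Uz.
exact: (is_derive_comp1 (g := expR) (smooth_is_derive i smf Uz) (is_derive_expR _)).
Qed.

Lemma hess_conformal z i j : U z -> dotd i (dotd j conformal) z =
  expR (f z) * (L z * (P i j z + dotd i f z * dotd j f z) +
    dotd j f z * l i z + dotd i f z * l j z + H i j z).
Proof.
move=> Uz.
have e : {near z, (fun w => expR (f w) * dotd j f w * L w + expR (f w) * l j w)
    =1 dotd j conformal}.
  apply: (near_eq_on openU) => // w Uw.
  by have [_ <-] := is_derive_mul (is_derive_expR_comp j Uw) (smooth_is_derive j smL Uw).
have df := smooth_is_derive i (smooth_dotd j smf) Uz.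
have dl := smooth_is_derive i (smooth_dotd j smL) Uz.
have de := is_derive_expR_comp i Uz.
have dL := smooth_is_derive i smL Uz.
have d := is_derive_add (is_derive_mul (is_derive_mul de df) dL) (is_derive_mul de dl).
have [_ d'] := near_eq_is_derive e d.
apply: etrans d' _.
move: (P i j z) (H i j z) => p h.
move: (dotd i f z) (dotd j f z) (l i z) (l j z) (expR _) (L z) => *; ring.
Qed.

(** Every factor except the determinant and the last bracket is non-zero, so this one identity
    serves both directions of the equivalence. *)
Lemma det_conformal z : U z ->
  L z ^+ 3 * \det (metric_mx conformal z) =
    conformal z ^+ 3 * expR (f z) * vol L z ^+ 2 *
    (sigma L f z - semi2 L f z ^+ 2 + signature L z).
Proof.
move=> Uz; rewrite (sigmaE Uz).
have V0 := lt0r_neq0 (vol_gt0 nondegL Uz).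
have L0 := L_neq0 Uz; have yl := L_euler smL homL Uz.
have e2 := signature_sqr nondegL Uz.
have dK := det_metricE openU coneU conformal_smooth conformal_homogeneous
  conformal_neq0 Uz.
have [k [hk HK _]] := hessE openU coneU conformal_smooth conformal_homogeneous
  conformal_neq0 Uz.
have dL := det_metricE openU coneU smL homL L_neq0 Uz.
have {}dK : \det (metric_mx conformal z) = conformal z ^+ 3 * k.
  by rewrite dK hk mulrA -exprS.
(* The Hessian of [e^f L] is contracted with the vector [rot l] of [L], on
   which the terms containing [l] vanish. *)
have hw : fibre_hess conformal z (rot (lv z)) = L z ^+ 2 * k.
  transitivity (\sum_i \sum_j rot (lv z) i * rot (lv z) j *
      (rot (fibre z) i * rot (fibre z) j * k)).
    by apply: eq_bigr => i _; apply: eq_bigr => j _; congr (_ * _); exact: HK.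
  rewrite !sum2 /rot /fibre /=.
  move: yl; move: (l 0 z) (l 1 z) (z.2 0 0) (z.2 0 1) (L z) => l0 l1 y0 y1 Lz <-; ring.
have hw' : L z * fibre_hess conformal z (rot (lv z)) = expR (f z) *
    (L z ^+ 2 * (\sum_i \sum_j rot (lv z) i * rot (lv z) j *
       (P i j z + dotd i f z * dotd j f z))
     + \det (metric_mx L z)).
  rewrite dL.
  transitivity (L z * \sum_i \sum_j rot (lv z) i * rot (lv z) j * (expR (f z) *
     (L z * (P i j z + dotd i f z * dotd j f z) +
    dotd j f z * l i z + dotd i f z * l j z + H i j z))).
    congr (_ * _); apply: eq_bigr => i _; apply: eq_bigr => j _; congr (_ * _).
    exact: hess_conformal.
  rewrite /fibre_hess.
  exact: (conformal_algebra _ _ _ (fun i j => H i j z) (fun i j => P i j z)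
    (fun i => dotd i f z)).
rewrite dK mulrCA [L z ^+ 3]exprS -[L z * _ * k]mulrA -hw hw' (det_vol nondegL Uz).
have hm : vol L z ^+ 2 * (\sum_i \sum_j (P i j z + dotd i f z * dotd j f z) *
    m_up L i z * m_up L j z) =
    \sum_i \sum_j rot (lv z) i * rot (lv z) j *
      (P i j z + dotd i f z * dotd j f z).
  rewrite mulr_sumr; apply: eq_bigr => i _; rewrite mulr_sumr; apply: eq_bigr => j _.
  rewrite !(m_upE openU coneU smL homL L_neq0 nondegL _ Uz).
  move: (rot _ i) (rot _ j) (P i j z + _) => wi wj p.
  transitivity (signature L z ^+ 2 * (wi * wj * p)); last by rewrite e2 mul1r.
  by field.
rewrite -hm.
by move: (\sum_i _) (conformal z) (expR _) (L z) (vol L z) (signature L z) => *; ring.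
Qed.

End conformal_change.

(** * Passage between the tangent bundle and a chart *)

Section coordinates.
Variables (R : realType) (M : smooth_surface R).
Implicit Types (c : chart R M) (A : set (tangent M)).

(** The component in one chart determines those in all charts around the base point through the
    transition differentials; the others are 0 by convention. *)
Lemma tcoords_inj c (v w : tangent M) :
  chart_at c (tbase v) -> chart_at c (tbase w) ->
  tcoords c v = tcoords c w -> v = w.
Proof.
case: v w => [p f fo fc] [q g go gc] /= cp cq [epq efg].
have pq : p = q by rewrite -(chart_mapK cp.2) epq (chart_mapK cq.2).
subst q.
have fg : f = g.
  apply/funext => d; have [dp|ndp] := pselect (chart_at d p).
    by rewrite (fc c d cp dp) (gc c d cp dp) efg.
  by rewrite fo// go.
by subst g; congr Tangent; exact: Prop_irrelevance.
Qed.

Lemma local_funE c (F : tangent M -> R) v :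
  chart_at c (tbase v) -> local_fun c F (tcoords c v) = F v.
Proof.
move=> cv; apply: xget_unique; first by exists v.
by move=> y [w cw [wv <-]]; rewrite (tcoords_inj cw cv wv).
Qed.

Lemma local_fun_out c (F : tangent M -> R) z :
  ~ (exists2 v, chart_at c (tbase v) & tcoords c v = z) -> local_fun c F z = 0.
Proof.
by move=> nz; apply: xgetPN => a [v cv [vz _]]; apply: nz; exists v.
Qed.

Lemma local_fun_conformal c (F phi : tangent M -> R) :
  local_fun c (fun v => expR (phi v) * F v) =
  conformal (local_fun c F) (local_fun c phi).
Proof.
apply/funext => z.
have [[v cv <-]|nz] := pselect (exists2 v, chart_at c (tbase v) & tcoords c v = z).
  by rewrite /conformal !local_funE.
(* Outside the range of the coordinates both sides take the default value 0, so the equality holds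
   as functions and can be rewritten under derivatives. *)
by rewrite /conformal !(local_fun_out _ nz) mulr0.
Qed.

Lemma local_set_scale c A (hA : conic_subbundle A) z (a : R) :
  local_set c A z -> 0 < a -> local_set c A (z.1, a *: z.2).
Proof.
move=> [v [Av cv] <-] a0; exists (tscale a v) => //.
by split=> //; exact: conic_scale.
Qed.

Lemma local_fun_homogeneous c A r (F : tangent M -> R) :
  pos_homogeneous A r F -> homogeneous_on (local_set c A) r (local_fun c F).
Proof.
move=> hF z a [v [Av cv] <-] a0.
rewrite (_ : (_, _) = tcoords c (tscale a v))//.
by rewrite !local_funE//; exact: hF.
Qed.

End coordinates.

Theorem theorem2p11 (R : realType) (M : smooth_surface R)
    (A : set (tangent M)) (F phi : tangent M -> R)
    (hA : conic_subbundle A)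
    (hF : conic_pseudo_Finsler A F)
    (hF0 : forall v, A v -> F v != 0)
    (hphi : smooth_fun A phi)
    (hphi0 : pos_homogeneous A 0 phi) :
  (forall (c : chart R M) (v : tangent M), A v -> chart_at c (tbase v) ->
     let L := local_fun c F in
     let f := local_fun c phi in
     let z := tcoords c v in
     sigma L f z - semi2 L f z ^+ 2 + signature L z =
     L z ^+ 2 *
       (\sum_i \sum_j (dotd i (dotd j f) z + dotd i f z * dotd j f z) *
                      m_up L i z * m_up L j z)
     + signature L z)
  /\
  (conic_pseudo_Finsler A (fun v => expR (phi v) * F v) <->
   forall (c : chart R M) (v : tangent M), A v -> chart_at c (tbase v) ->
     let L := local_fun c F in
     let f := local_fun c phi in
     let z := tcoords c v in
     sigma L f z - semi2 L f z ^+ 2 + signature L z != 0).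
Proof.
have U_open c : surf_atlas c -> open (local_set c A) by exact: conic_open.
have coneU c := @local_set_scale R M c A hA.
have homL c := local_fun_homogeneous (c := c) (cpF_homogeneous hF).
have homf c := local_fun_homogeneous (c := c) hphi0.
have L_neq0 c z : local_set c A z -> local_fun c F z != 0.
  by move=> [v [Av cv] <-]; rewrite local_funE// hF0.
have nondegL c z : local_set c A z -> metric_mx (local_fun c F) z \in unitmx.
  by move=> [v [Av cv] <-]; exact: (cpF_nondegenerate hF Av cv).
have inU c v : A v -> chart_at c (tbase v) -> local_set c A (tcoords c v).
  by move=> Av cv; exists v.
have detK c v (Av : A v) (cv : chart_at c (tbase v)) :=
  det_conformal (U_open _ cv.1) (coneU c) (cpF_smooth hF cv.1) (homL c) (L_neq0 c)
    (nondegL c) (hphi _ cv.1) (homf c) (inU _ _ Av cv).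
split=> [c v Av cv /=|].
  exact: (sigmaE (U_open _ cv.1) (coneU c) (cpF_smooth hF cv.1) (homL c)
    (L_neq0 c) (nondegL c) (hphi _ cv.1) (homf c) (inU _ _ Av cv)).
split=> [hK c v Av cv /=|X0].
  have := cpF_nondegenerate hK Av cv.
  (* If the bracket vanished, L^3 times the new determinant would be 0, with [L] non-zero. *)
  rewrite local_fun_conformal unitmxE unitfE; apply: contraNneq => X0.
  have L0 := L_neq0 _ _ (inU _ _ Av cv).
  move: (detK c v Av cv); rewrite X0 mulr0 => /eqP.
  by rewrite mulf_eq0 expf_eq0 (negbTE L0).
split=> [c cA|v a Av a0|c v Av cv].
- rewrite local_fun_conformal.
  exact: (conformal_smooth (U_open _ cA) (cpF_smooth hF cA) (hphi _ cA)).
- by rewrite (cpF_homogeneous hF)// hphi0// expr0 mul1r mulrCA.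
- have zU := inU _ _ Av cv.
  have K0 := conformal_neq0 (L_neq0 c) (local_fun c phi) zU.
  have s0 := lt0r_neq0 (vol_gt0 (nondegL c) zU).
  rewrite local_fun_conformal unitmxE unitfE.
  have e0 : expR (local_fun c phi (tcoords c v)) != 0 by rewrite gt_eqF// expR_gt0.
  (* Conversely, a zero determinant would make a product of non-zero factors vanish. *)
  apply/eqP => d0; have /eqP := detK c v Av cv; rewrite d0 mulr0 eq_sym.
  apply/negP; apply: mulf_neq0 (X0 c v Av cv).
  exact: mulf_neq0 (mulf_neq0 (expf_neq0 3 K0) e0) (expf_neq0 2 s0).
Qed.
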